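(* Let $X$ be a Banach space, and let $\mathcal{A}$ be a finite set of hyperbolic linear homeomorphisms of $X$ with the same stable and unstable subspaces. Then any time varying map $\mathcal{F}=\{f_{n}\}_{n\in\mathbb{N}}$ on $X$ with $f_{n}\in\mathcal{A}$ for all $n\in\mathbb{N}$ has the shadowing, limit shadowing, s-limit shadowing and exponential limit shadowing properties.
   Context: $\mathbb{N}=\{1,2,3,\dots\}$. A linear homeomorphism $f:X\to X$ on a Banach space $X$ is hyperbolic if there exist Banach subspaces $X_s,X_u\subset X$, called the stable and unstable subspaces, respectively, and a norm $\|\cdot\|$ on $X$ compatible with the original Banach structure such that $X=X_s\oplus X_u$, $f(X_s)=X_s$, $f(X_u)=X_u$, $\|f|_{X_s}\|<1$ and $\|f^{-1}|_{X_u}\|<1$. A time varying map on a metric space $(X,d)$ (here $d$ is the metric induced by the norm of $X$) is a sequence $\mathcal{F}=\{f_n\}_{n\in\mathbb{N}}$ of continuous maps $f_n:X\to X$. Put $\mathcal{F}_n:=f_n\circ f_{n-1}\circ\cdots\circ f_1$ for $n\ge 1$ and $\mathcal{F}_0:=\mathrm{Id}_X$. For $\delta>0$, a sequence $\{x_n\}_{n\ge 0}$ in $X$ is a $\delta$-pseudo orbit of $\mathcal{F}$ if $d(f_{n+1}(x_n),x_{n+1})<\delta$ for all $n\ge 0$. It is a limit pseudo orbit if $d(f_{n+1}(x_n),x_{n+1})\to 0$ as $n\to+\infty$. For a real sequence $\{a_n\}_{n\ge0}$ and $\theta\in(0,1)$ write $a_n\xrightarrow{\theta}0$ if there is $L>0$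 with $|a_n|\le L\theta^n$ for all $n\ge0$; $\{x_n\}_{n\ge0}$ is a $\theta$-exponentially limit pseudo orbit if $d(f_{n+1}(x_n),x_{n+1})\xrightarrow{\theta}0$. Shadowing property: for every $\varepsilon>0$ there is $\delta>0$ such that for every $\delta$-pseudo orbit $\{x_n\}_{n\ge0}$ in $X$ there is $x\in X$ with $d(\mathcal{F}_n(x),x_n)<\varepsilon$ for all $n\ge0$. Limit shadowing property: for every limit pseudo orbit $\{x_n\}_{n\ge0}$ in $X$ there is $x\in X$ with $d(\mathcal{F}_n(x),x_n)\to 0$ as $n\to+\infty$. Exponential limit shadowing property: there exists $\theta_0\in(0,1)$ such that for every $\theta\in(\theta_0,1)$ and every $\theta$-exponentially limit pseudo orbit $\{x_n\}_{n\ge0}$ in $X$ there is $x\in X$ with $d(\mathcal{F}_n(x),x_n)\xrightarrow{\theta}0$. s-limit shadowing property: for every $\varepsilon>0$ there is $\delta>0$ such that (1) for every $\delta$-pseudo orbit $\{x_n\}_{n\ge0}$ in $X$ there exists $x\in X$ with $d(\mathcal{F}_n(x),x_n)<\varepsilon$ for all $n\ge 0$, and (2) if in addition $\{x_n\}_{n\ge0}$ is a limit pseudo orbit, then (this $x$ can be taken so that) $d(\mathcal{F}_n(x),x_n)\to0$ as $n\to+\infty$.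
   Formalization: The hyperbolic maps in the finite set are assumed to share one adapted norm as well as the same stable and unstable subspaces; with separate norms the claim fails, e.g. for M = [[1/2,3/4],[0,1/2]] and its transpose on the plane. *)

(* Defs.v *)
From mathcomp Require Import all_boot all_order all_algebra.
From mathcomp Require Import all_classical all_reals all_analysis.
Set Implicit Arguments.
Unset Strict Implicit.
Unset Printing Implicit Defensive.
Import Order.TTheory GRing.Theory Num.Theory.
Import numFieldNormedType.Exports.
Local Open Scope classical_set_scope.
Local Open Scope ring_scope.

Section Hyperbolic.
Context {R : realType} {X : normedModType R}.

(* The axioms of [Lmodule_isNormed], for a second norm on the carrier of [X];
   nonnegativity and [N 0 = 0] follow from them. *)
Definition is_norm (N : X -> R) : Prop :=
  [/\ forall x y, N (x + y) <= N x + N y,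
      forall (a : R) x, N (a *: x) = `|a| * N x
    & forall x, N x = 0 -> x = 0].

Definition equivalent_norm (N : X -> R) : Prop :=
  exists c C : R, [/\ 0 < c, 0 < C
    & forall x, c * `|x| <= N x /\ N x <= C * `|x|].

Definition banach_subspace (V : set X) : Prop :=
  submod_closed [in V] /\ closed V.

Definition direct_sum (V W : set X) : Prop :=
  V `&` W = [set 0] /\
  forall x, exists v w, [/\ V v, W w & x = v + w].

(* Operator norm of the restriction of [f] to [V], both sides measured by [N];
   extended-real valued, so that it is [+oo] on unbounded operators. *)
Definition restr_opnorm (N : X -> R) (V : set X) (f : X -> X) : \bar R :=
  ereal_sup [set (N (f x))%:E | x in [set x | V x /\ N x <= 1]].

Definition linear_homeo (f g : X -> X) : Prop :=
  [/\ linear f, continuous f, continuous g, cancel f g & cancel g f].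

(* [f] is a hyperbolic linear homeomorphism with stable subspace [Xs], unstable
   subspace [Xu] and adapted norm [N]; the map [g] is the inverse of [f]. *)
Definition hyperbolic_with (Xs Xu : set X) (N : X -> R) (f : X -> X) : Prop :=
  [/\ banach_subspace Xs, banach_subspace Xu, direct_sum Xs Xu,
      is_norm N /\ equivalent_norm N
    & exists g, [/\ linear_homeo f g, f @` Xs = Xs, f @` Xu = Xu,
                    (restr_opnorm N Xs f < 1)%E & (restr_opnorm N Xu g < 1)%E]].

Definition hyperbolic (f : X -> X) : Prop :=
  exists Xs Xu N, hyperbolic_with Xs Xu N f.

(* Being contracting depends on the norm, and a product of contractions for
   different norms need not be contracting: the 2x2 matrices
   ((1/2, 3/4), (0, 1/2)) and its transpose have spectral radius 1/2, but 1 is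
   an eigenvalue of their product.  A family shares its stable and unstable
   subspaces when it does so as normed subspaces, i.e. for one adapted norm. *)
Definition jointly_hyperbolic (A : set (X -> X)) : Prop :=
  exists Xs Xu N, forall f, A f -> hyperbolic_with Xs Xu N f.

Lemma jointly_hyperbolicW (A : set (X -> X)) f :
  jointly_hyperbolic A -> A f -> hyperbolic f.
Proof. by move=> [Xs [Xu [N h]]] /h hf; exists Xs, Xu, N. Qed.

End Hyperbolic.

(* A time varying map is a sequence [f 1, f 2, ...]; the value [f 0] is never
   used. *)
Section TimeVarying.
Context {R : realType} {X : normedModType R}.
Implicit Types (f : nat -> X -> X) (x : nat -> X).

Fixpoint tv_iter f (n : nat) : X -> X :=
  if n is m.+1 then f m.+1 \o tv_iter f m else id.

Definition pseudo_orbit f (delta : R) x : Prop :=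
  forall n, `|f n.+1 (x n) - x n.+1| < delta.

Definition limit_pseudo_orbit f x : Prop :=
  `|f n.+1 (x n) - x n.+1| @[n --> \oo] --> (0 : R).

Definition exp_cvg0 (theta : R) (a : nat -> R) : Prop :=
  exists2 L : R, 0 < L & forall n, `|a n| <= L * theta ^+ n.

Definition exp_limit_pseudo_orbit f (theta : R) x : Prop :=
  exp_cvg0 theta (fun n => `|f n.+1 (x n) - x n.+1|).

Definition eps_shadows f (eps : R) (p : X) x : Prop :=
  forall n, `|tv_iter f n p - x n| < eps.

Definition limit_shadows f (p : X) x : Prop :=
  `|tv_iter f n p - x n| @[n --> \oo] --> (0 : R).

Definition shadowing f : Prop :=
  forall eps : R, 0 < eps -> exists2 delta : R, 0 < delta &
    forall x, pseudo_orbit f delta x -> exists p, eps_shadows f eps p x.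

Definition limit_shadowing f : Prop :=
  forall x, limit_pseudo_orbit f x -> exists p, limit_shadows f p x.

Definition exp_limit_shadowing f : Prop :=
  exists theta0 : R, [/\ 0 < theta0, theta0 < 1
    & forall theta, theta0 < theta -> theta < 1 ->
      forall x, exp_limit_pseudo_orbit f theta x ->
      exists p, exp_cvg0 theta (fun n => `|tv_iter f n p - x n|)].

Definition s_limit_shadowing f : Prop :=
  forall eps : R, 0 < eps -> exists2 delta : R, 0 < delta &
    forall x, pseudo_orbit f delta x ->
      (exists p, eps_shadows f eps p x) /\
      (limit_pseudo_orbit f x ->
       exists p, eps_shadows f eps p x /\ limit_shadows f p x).

End TimeVarying.

(* Main.v *)
(* Let [e n = x n.+1 - f n.+1 (x n)] be the errors of a pseudo orbit [x].  The
   differences [y n = tv_iter f n p - x n] solve [y n.+1 = f n.+1 (y n) - e n],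
   and every solution arises in this way, from [p = x 0 + y 0]; so a small
   solution is wanted.  Split [e n] along [Xs] and [Xu], solve the stable
   component forward in time from [0], and the unstable one backward, by the
   convergent series of the pull-backs of the later errors.  Both are bounded by
   convolutions of the sizes of the errors with a geometric kernel of ratio
   [lam < 1], a uniform contraction rate for the finite family; so they inherit
   boundedness, convergence to [0], and decay at any rate [theta > lam]. *)
Require Import Defs.
From HB Require Import structures.
From mathcomp Require Import all_boot all_order all_algebra.
From mathcomp Require Import all_classical all_reals all_analysis.
From mathcomp Require Import ring lra.
Set Implicit Arguments.
Unset Strict Implicit.
Unset Printing Implicit Defensive.
Import Order.TTheory GRing.Theory Num.Theory.
Import numFieldNormedType.Exports.
Local Open Scope classical_set_scope.
Local Open Scope ring_scope.

(** * Uniform rates over a finite family *)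

Lemma finite_uniform_lt1 (R : realType) (T : Type) (A : set T)
    (P : T -> R -> Prop) :
  finite_set A ->
  (forall t r s, r <= s -> P t r -> P t s) ->
  (forall t, A t -> exists2 r, r < 1 & P t r) ->
  exists r, [/\ 0 < r, r < 1 & forall t, A t -> P t r].
Proof.
move=> Afin Pmono AP.
have /choice[r rP] t : exists r, A t -> r < 1 /\ P t r.
  by have [/AP[r]|nAt] := pselect (A t); [exists r|exists 0].
have /finite_seqP[s rAs] := finite_image r Afin.
have rs t : A t -> r t \in s.
  by move=> At; have : [set` s] (r t) by rewrite -rAs; exists t.
(* The seed 1/2 keeps the maximum positive, even when [A] is empty. *)
exists (\big[Order.max/2^-1]_(i <- s) i); split.
- by rewrite (lt_le_trans _ (bigmax_ge_id _ _ _ _))// invr_gt0 ltr0n.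
- rewrite big_seq; apply: bigmax_lt; first by rewrite invf_lt1 ?ltr0n// ltr1n.
  move=> z zs; have : [set` s] z by [].
  by rewrite -rAs => -[t /rP[r1 _] <-].
- move=> t At; have [_] := rP t At.
  by apply/Pmono/le_bigmax_seq => //; exact: rs.
Qed.

(** * Adapted norms and contraction rates *)

Section AdaptedNorm.
Context {R : realType} {X : normedModType R} (N : X -> R) (Nnorm : is_norm N).

Lemma adapted_normD x y : N (x + y) <= N x + N y.
Proof. by have [+ _ _] := Nnorm; exact. Qed.

Lemma adapted_normZ a x : N (a *: x) = `|a| * N x.
Proof. by have [_ + _] := Nnorm; exact. Qed.

Lemma adapted_norm0 : N 0 = 0.
Proof. by rewrite -(scale0r 0) adapted_normZ normr0 mul0r. Qed.

Lemma adapted_normN x : N (- x) = N x.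
Proof. by rewrite -scaleN1r adapted_normZ normrN1 mul1r. Qed.

Lemma adapted_normB x y : N (x - y) <= N x + N y.
Proof. by rewrite -(adapted_normN y) adapted_normD. Qed.

Lemma adapted_norm_ge0 x : 0 <= N x.
Proof. by have := adapted_normB x x; rewrite subrr adapted_norm0; lra. Qed.

(** The rate is the operator norm itself, a real number because it lies between 0 and 1; a vector
    with [N v] nonzero is rescaled to the unit sphere. *)
Lemma restr_opnorm_lt1 (V : set X) (f : X -> X) :
  linear f -> submod_closed [in V] -> (restr_opnorm N V f < 1)%E ->
  exists2 r, r < 1 & forall v, V v -> N (f v) <= r * N v.
Proof.
move=> lf [V0 VZD] S1.
have [_ _ Neq0] := Nnorm.
pose F : {linear X -> X} := HB.pack f (GRing.isLinear.Build _ _ _ _ f lf).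
have f0 : f 0 = 0 by exact: (linear0 F).
have fZ a v : f (a *: v) = a *: f v by exact: (linearZ_LR F).
have VZ a v : V v -> V (a *: v).
  move=> Vv; have := VZD a v 0; rewrite addr0 !inE; apply=> //.
  by rewrite inE in V0.
have Sub v : V v -> N v <= 1 -> ((N (f v))%:E <= restr_opnorm N V f)%E.
  by move=> Vv Nv; apply: ereal_sup_ubound; exists v.
have S0 : (0 <= restr_opnorm N V f)%E.
  have := Sub 0; rewrite f0 adapted_norm0; apply=> //.
  by rewrite inE in V0.
have Sfin : restr_opnorm N V f \is a fin_num.
  by rewrite ge0_fin_numE// (lt_trans S1)// ltry.
exists (fine (restr_opnorm N V f)); first by rewrite -lte_fin fineK.
move=> v Vv; have [Nv0|Nv0] := eqVneq (N v) 0.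
  by rewrite Nv0 (Neq0 v Nv0) f0 adapted_norm0 mulr0.
have Nvgt0 : 0 < N v by rewrite lt_neqAle eq_sym Nv0 adapted_norm_ge0.
have := Sub ((N v)^-1 *: v) (VZ _ _ Vv).
rewrite fZ !adapted_normZ gtr0_norm ?invr_gt0// mulVf// => /(_ (lexx 1)).
rewrite -{1}(fineK Sfin) lee_fin => h.
by rewrite -ler_pdivrMr// mulrC.
Qed.

End AdaptedNorm.

(** * Solving the error recursion in each subspace *)

(** The size of [u] is controlled by comparison: [a] is any supersolution of the scalar recursion,
    so one statement yields both constant and geometric bounds. Starting at [n0] is harmless, since
    [u n] only sees errors from time [n] on. *)
Lemma backward_solution (R : realType) (X : completeNormedModType R)
    (N : X -> R) (Nnorm : is_norm N) (Nequiv : equivalent_norm N)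
    (W : set X) (W0 : W 0) (WD : forall x y, W x -> W y -> W (x + y))
    (lam : R) (lam0 : 0 < lam) (lam1 : lam < 1) (g : nat -> X -> X)
    (gD : forall n x y, g n (x + y) = g n x + g n y)
    (gcont : forall n, continuous (g n))
    (gW : forall n w, W w -> W (g n w) /\ N (g n w) <= lam * N w)
    (e : nat -> X) (eW : forall n, W (e n)) (E : R)
    (eE : forall n, N (e n) <= E) :
  exists2 u : nat -> X, forall n, u n = g n (u n.+1 + e n) &
    forall n0 (a : nat -> R),
      (forall n, (n0 <= n)%N -> 0 <= a n /\ lam * (a n.+1 + N (e n)) <= a n) ->
      forall n, (n0 <= n)%N -> N (u n) <= a n.
Proof.
have [c [C [c0 C0 cNC]]] := Nequiv.
have g0 n : g n 0 = 0 by apply: (addrI (g n 0)); rewrite -gD !addr0.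
(* [T i n] pulls [e (n + i)] back to time [n] along [g (n + i)], ..., [g n]; these [i.+1] maps give
   the factor [lam ^+ i.+1]. *)
pose T := fix T i n := if i is j.+1 then g n (T j n.+1) else g n (e n).
have TW i n : W (T i n) /\ N (T i n) <= lam ^+ i.+1 * E.
  elim: i n => [|i IHi] n /=.
    have [gWn gN] := gW n _ (eW n); split => //.
    by rewrite expr1 (le_trans gN)// ler_wpM2l// ltW.
  have [TW TN] := IHi n.+1; have [gWn gN] := gW n _ TW; split => //.
  by rewrite (le_trans gN)// exprS -mulrA ler_wpM2l// ltW.
pose S n := series (T ^~ n).
have SS n m : S n m.+1 = g n (S n.+1 m + e n).
  rewrite /S /series/= big_nat_recl//= addrC gD; congr (_ + _).
  by rewrite (big_morph (g n) (gD n) (g0 n)).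
have SW n m : W (S n m).
  elim: m n => [|m IHm] n; first by rewrite /S /series/= big_geq.
  by rewrite SS; have [] := gW n _ (WD _ _ (IHm n.+1) (eW n)).
have Scvg n : cvgn (S n).
  apply: normed_cvg.
  apply: (@series_le_cvg _ _ (geometric (c^-1 * lam * E) lam)) => [i|i|i|].
  - exact: normr_ge0.
  - rewrite /geometric/= !mulr_ge0 ?exprn_ge0 ?invr_ge0 ?(ltW c0) ?(ltW lam0)//.
    exact: le_trans (adapted_norm_ge0 Nnorm (e 0%N)) (eE 0%N).
  - rewrite /geometric/= -2!mulrA ler_pdivlMl// (le_trans (cNC _).1)//.
    by rewrite (le_trans (TW _ _).2)// exprS -!mulrA [E * _]mulrC.
  - by apply: is_cvg_geometric_series; rewrite gtr0_norm.
exists (fun n => limn (S n)) => [n|n0 a an n n0n].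
  (* Both sides are the limit of [S n m.+1] in [m]: the left as a shifted sequence, the right by
     [SS] and continuity of [g n]. *)
  apply: (@cvg_unique _ _ (S n m.+1 @[m --> \oo])).
  - exact: norm_hausdorff.
  - by have := Scvg n; rewrite -(cvg_shiftS (S n)); exact.
  - have -> : (fun m => S n m.+1) = (fun m => g n (S n.+1 m + e n)).
      exact/funext/SS.
    apply: continuous_cvg; first exact: gcont.
    by apply: cvgD; [exact: Scvg|exact: cvg_cst].
have Sa m k : (n0 <= k)%N -> N (S k m) <= a k.
  elim: m k => [|m IHm] k n0k.
    by rewrite /S /series/= big_geq// adapted_norm0//; have [] := an k n0k.
  have [_ ak] := an k n0k.
  have [_ gN] := gW k _ (WD _ _ (SW k.+1 m) (eW k)).
  rewrite SS (le_trans gN)// (le_trans _ ak)// ler_wpM2l ?(ltW lam0)//.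
  by rewrite (le_trans (adapted_normD Nnorm _ _))// lerD2r IHm// ltnW.
(* The bound passes from partial sums to the limit: a remainder of norm below [eps / C] has [N]-size
   at most [eps]. *)
apply/ler_addgt0Pr => eps eps0.
have /cvgrPdist_lt /(_ (eps / C)) := Scvg n.
rewrite divr_gt0// => /(_ isT)[m _ /(_ m (leqnn m))/= Sm].
rewrite -(subrK (S n m) (limn _)) addrC (le_trans (adapted_normD Nnorm _ _))//.
rewrite lerD ?Sa// (le_trans (cNC _).2)// -ler_pdivlMl// mulrC.
exact: ltW.
Qed.

(** Again a comparison with supersolutions. Restarting at [n0] condenses all earlier errors into the
    initial value [N (s n0)]. *)
Lemma forward_solution (R : realType) (X : normedModType R) (N : X -> R)
    (Nnorm : is_norm N) (V : set X) (V0 : V 0)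
    (VB : forall x y, V x -> V y -> V (x - y)) (lam : R) (lam0 : 0 < lam)
    (f : nat -> X -> X)
    (fV : forall n v, V v -> V (f n v) /\ N (f n v) <= lam * N v)
    (e : nat -> X) (eV : forall n, V (e n)) :
  exists s : nat -> X, [/\ s 0%N = 0, forall n, s n.+1 = f n (s n) - e n &
    forall n0 (a : nat -> R), N (s n0) <= a n0 ->
      (forall n, (n0 <= n)%N -> lam * a n + N (e n) <= a n.+1) ->
      forall n, (n0 <= n)%N -> N (s n) <= a n].
Proof.
pose s := fix s n := if n is m.+1 then f m (s m) - e m else 0.
have sV n : V (s n).
  by elim: n => //= n IHn; apply: VB => //; have [] := fV n _ IHn.
exists s; split => // n0 a sa an; elim=> [|n IHn].
  by rewrite leqn0 => /eqP n00; rewrite -n00.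
rewrite leq_eqVlt => /predU1P[<-//|n0n].
have [_ fN] := fV n _ (sV n).
rewrite (le_trans (adapted_normB Nnorm _ _))// (le_trans _ (an n n0n))//.
by rewrite lerD2r (le_trans fN)// ler_wpM2l ?(ltW lam0)// IHn.
Qed.

(** * Boundedness of the two projections *)

(* If [x] is small then so is [f x], and then [v] contracting and [w] expanding
   under [f] leave no room for [v] and [w] to be large and nearly opposite. *)
Lemma hyperbolic_projections_bounded (R : realType) (X : normedModType R)
    (N : X -> R) (Nnorm : is_norm N) (V W : set X) (VW : direct_sum V W)
    (lam : R) (lam0 : 0 < lam) (lam1 : lam < 1) (f g : X -> X)
    (fD : forall x y, f (x + y) = f x + f y) (fK : cancel f g) (B : R)
    (fB : forall x, N (f x) <= B * N x)
    (fV : forall v, V v -> N (f v) <= lam * N v)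
    (fW : forall w, W w -> W (f w))
    (gW : forall w, W w -> N (g w) <= lam * N w) :
  exists2 K : R, 0 < K & forall x, exists v w,
    [/\ V v, W w, x = v + w, N v <= K * N x & N w <= K * N x].
Proof.
have lam2 : 0 < 1 - lam ^+ 2 by rewrite subr_gt0 expr_lt1// ltW.
(* Solves [N w <= lam * (|B| * N x + lam * (N x + N w))] for [N w]. *)
pose k := (lam * `|B| + lam ^+ 2) / (1 - lam ^+ 2).
have k0 : 0 <= k.
  rewrite divr_ge0 ?(ltW lam2)// addr_ge0 ?exprn_ge0 ?(ltW lam0)//.
  by rewrite mulr_ge0 ?(ltW lam0).
have := VW => -[_ VWsum].
exists (1 + k); first by rewrite ltr_pwDl.
move=> x; have [v [w [Vv Ww xE]]] := VWsum x; exists v, w.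
have Nx := adapted_norm_ge0 Nnorm x.
have NfwE : N (f w) <= N (f x) + N (f v).
  by rewrite (_ : f w = f x - f v) ?adapted_normB// xE fD addrC addKr.
have NvE : N v <= N x + N w.
  by rewrite (_ : v = x - w) ?adapted_normB// xE addrK.
have Nw : N w <= k * N x.
  rewrite /k mulrAC ler_pdivlMr//.
  have := gW _ (fW _ Ww); rewrite fK => Nw.
  have NfvE := fV _ Vv.
  have NfxE : N (f x) <= `|B| * N x.
    by rewrite (le_trans (fB x))// ler_wpM2r// ler_norm.
  have : lam * N (f w) <= lam * (`|B| * N x + lam * (N x + N w)).
    rewrite ler_wpM2l ?(ltW lam0)// (le_trans NfwE)// lerD//.
    by rewrite (le_trans NfvE)// ler_wpM2l// ltW.
  by lra.
split => //; first by lra.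
by rewrite mulrDl mul1r (le_trans Nw)// lerDr.
Qed.

(** * Small corrections for small errors *)

(** A single [y], the sum of the forward and backward solutions, satisfies all the estimates at
    once; s-limit shadowing relies on this. *)
Lemma hyperbolic_correction (R : realType) (X : completeNormedModType R)
    (N : X -> R) (Nnorm : is_norm N) (Nequiv : equivalent_norm N)
    (V W : set X) (V0 : V 0) (VB : forall x y, V x -> V y -> V (x - y))
    (W0 : W 0) (WD : forall x y, W x -> W y -> W (x + y)) (K : R) (K0 : 0 < K)
    (VW : forall x, exists v w,
      [/\ V v, W w, x = v + w, N v <= K * N x & N w <= K * N x])
    (lam : R) (lam0 : 0 < lam) (lam1 : lam < 1) (f g : nat -> X -> X)
    (fD : forall n x y, f n (x + y) = f n x + f n y)
    (gD : forall n x y, g n (x + y) = g n x + g n y)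
    (gcont : forall n, continuous (g n)) (gK : forall n, cancel (g n) (f n))
    (fV : forall n v, V v -> V (f n v) /\ N (f n v) <= lam * N v)
    (gW : forall n w, W w -> W (g n w) /\ N (g n w) <= lam * N w) :
  exists2 M : R, 0 < M & forall e : nat -> X,
    (exists E, forall n, `|e n| <= E) -> exists y : nat -> X,
    [/\ forall n, y n.+1 = f n (y n) - e n,
        forall d, (forall n, `|e n| <= d) -> forall n, `|y n| <= M * d,
        `|e n| @[n --> \oo] --> (0 : R) -> `|y n| @[n --> \oo] --> (0 : R)
      & forall theta, lam < theta -> theta < 1 ->
        exp_cvg0 theta (fun n => `|e n|) -> exp_cvg0 theta (fun n => `|y n|)].
Proof.
have [c [C [c0 C0 cNC]]] := Nequiv.
have lam1' : 0 < 1 - lam by rewrite subr_gt0.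
(* Errors of norm at most [d] have components of [N]-size at most [D = K * C * d]. The fixed point
   [D / (1 - lam)] of [b = lam * b + D] bounds each of the two solutions, and [c] converts back to
   the original norm. *)
pose M := 2 * (K * C / (1 - lam)) / c.
have M0 : 0 < M by rewrite /M !(mulr_gt0, invr_gt0)// ltr0n.
exists M => // e [E eE].
have /choice[v /choice[w vw]] n := VW (e n).
have NKC x r : `|x| <= r -> K * N x <= K * C * r.
  move=> xr; rewrite -mulrA ler_pM2l// (le_trans (cNC x).2)//.
  by rewrite ler_pM2l.
have vN n r : `|e n| <= r -> N (v n) <= K * C * r.
  by have [_ _ _ + _] := vw n => /le_trans h /NKC; exact: h.
have wN n r : `|e n| <= r -> N (w n) <= K * C * r.
  by have [_ _ _ _ +] := vw n => /le_trans h /NKC; exact: h.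
have vV n : V (v n) by have [] := vw n.
have wW n : W (w n) by have [] := vw n.
have [s [s0 sE sle]] := forward_solution Nnorm V0 VB lam0 fV vV.
have [u uE ule] := backward_solution Nnorm Nequiv W0 WD lam0 lam1 gD gcont gW
  wW (fun n => wN n _ (eE n)).
have yle n r t : N (s n) <= r -> N (u n) <= t -> `|s n + u n| <= (r + t) / c.
  move=> sr ut; rewrite ler_pdivlMr// mulrC (le_trans (cNC _).1)//.
  by rewrite (le_trans (adapted_normD Nnorm _ _))// lerD.
(* Errors before [n0] survive only as a transient decaying like [lam ^+ (n - n0)]. *)
have tail n0 d : (forall n, (n0 <= n)%N -> `|e n| <= d) ->
    forall n, (n0 <= n)%N ->
    `|s n + u n| <= M * d + N (s n0) / c * lam ^+ (n - n0).
  move=> ed.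
  have d0 : 0 <= d by exact: le_trans (normr_ge0 _) (ed n0 (leqnn _)).
  set D := K * C * d; set b := D / (1 - lam).
  have D0 : 0 <= D by rewrite /D !mulr_ge0// ltW.
  have b0 : 0 <= b by rewrite /b divr_ge0// ltW.
  have bE : lam * b + D = b by rewrite /b; field; rewrite gt_eqF.
  move=> n n0n.
  rewrite (_ : _ + _ = (b + N (s n0) * lam ^+ (n - n0) + b) / c); last first.
    by rewrite /M /b /D; field; rewrite !gt_eqF.
  apply: yle.
    apply: (sle n0 (fun n => b + N (s n0) * lam ^+ (n - n0))) => //.
      by rewrite subnn expr0 mulr1 lerDr.
    move=> m n0m; rewrite subSn// exprS.
    by have := vN m d (ed m n0m); rewrite -/D; lra.
  apply: (ule n0 (fun=> b)) => // m n0m; split => //.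
  have := wN m d (ed m n0m); rewrite -/D => wD.
  have : lam * N (w m) <= D.
    by rewrite (le_trans _ wD)// ler_piMl ?adapted_norm_ge0// ltW.
  by lra.
exists (fun n => s n + u n); split.
- move=> n; have [_ _ -> _ _] := vw n.
  by rewrite sE fD (uE n) gK opprD [RHS]addrACA addrK.
- move=> d ed n; have := tail 0%N d (fun n _ => ed n) n (leq0n n).
  by rewrite s0 adapted_norm0// mul0r mul0r addr0.
(* [n0] makes the later errors contribute at most [eps / 2]; waiting [n1] more steps brings the
   transient below [eps / 2]. *)
- move=> /cvgr0Pnorm_lt elim0; apply/cvgr0Pnorm_lt => eps eps0.
  have /elim0[n0 _ en0] : 0 < eps / 2 / M.
    by rewrite !(mulr_gt0, invr_gt0)// ltr0n.
  have ed n : (n0 <= n)%N -> `|e n| <= eps / 2 / M.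
    by move=> /en0/=; rewrite normr_id => /ltW.
  have /cvgr0Pnorm_lt /(_ (eps / 2)) : geometric (N (s n0) / c) lam n
      @[n --> \oo] --> (0 : R) by apply: cvg_geometric; rewrite gtr0_norm.
  rewrite divr_gt0// => /(_ isT)[n1 _ geo].
  exists (n0 + n1)%N => // n /= n01n.
  have n0n : (n0 <= n)%N by exact: leq_trans (leq_addr _ _) n01n.
  rewrite normr_id (le_lt_trans (tail n0 _ ed n n0n))//.
  rewrite mulrC divfK ?gt_eqF// [ltRHS](splitr eps) ltrD2l.
  by rewrite (le_lt_trans (ler_norm _))// geo//= leq_subRL.
- move=> th lamth th1 [L L0 eL].
  have th0 : 0 < th by exact: lt_trans lamth.
  have thlam : 0 < th - lam by rewrite subr_gt0.
  (* [b] is chosen so that [b * th ^+ n] solves the forward scalar recursion with errors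
     [D * th ^+ n]; this is where [lam < th] enters. *)
  set D := K * C * L; set b := D / (th - lam).
  have D0 : 0 < D by rewrite /D !mulr_gt0.
  have b0 : 0 < b by rewrite /b divr_gt0.
  have bE : lam * b + D = b * th by rewrite /b; field; rewrite gt_eqF.
  have eD n : `|e n| <= L * th ^+ n by rewrite -[leLHS]normr_id.
  exists ((b + b) / c); first by rewrite divr_gt0// addr_gt0.
  move=> n; rewrite normr_id mulrAC mulrDl; apply: yle.
    apply: (sle 0%N (fun n => b * th ^+ n)) => //.
      by rewrite s0 adapted_norm0// expr0 mulr1 ltW.
    move=> m _; rewrite exprS (mulrA b) -bE mulrDl -mulrA lerD2l.
    by rewrite /D -mulrA; exact: vN.
  apply: (ule 0%N (fun n => b * th ^+ n)) => // m _.
  have thm : 0 < th ^+ m by rewrite exprn_gt0.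
  split; first by rewrite mulr_ge0 ?ltW.
  have wD : N (w m) <= D * th ^+ m by rewrite /D -mulrA; exact: wN.
  have lw : lam * N (w m) <= D * th ^+ m.
    by rewrite (le_trans _ wD)// ler_piMl ?adapted_norm_ge0// ltW.
  have bth : b * th <= b by rewrite ler_piMr// ltW.
  (* The same [b] works backward: [lam * b * th + D <= lam * b + D = b * th <= b]. *)
  have lbth : lam * (b * th) + D <= b.
    by have := ler_wpM2l (ltW lam0) bth; lra.
  rewrite exprS mulrDr (le_trans (lerD (lexx _) lw))//.
  by have := ler_wpM2r (ltW thm) lbth; lra.
Qed.

(** * From corrections to the shadowing properties *)

Theorem theorem5p12 (R : realType) (X : completeNormedModType R)
    (A : set (X -> X)) (Afin : finite_set A) (Ahyp : jointly_hyperbolic A)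
    (f : nat -> X -> X) (fA : forall n : nat, (1 <= n)%N -> A (f n)) :
  shadowing f /\ limit_shadowing f /\ s_limit_shadowing f /\
  exp_limit_shadowing f.
Proof.
have [Xs [Xu [N Ah]]] := Ahyp.
have [[Xs_sub _] [Xu_sub _] XsXu [Nnorm Nequiv]] := Ah _ (fA 1%N isT).
move=> [_ [[f1lin f1cont _ _ _] _ _ _ _]].
have [c [C [c0 C0 cNC]]] := Nequiv.
have linD (h : X -> X) : linear h -> forall x y, h (x + y) = h x + h y.
  by move=> hl x y; have := hl 1 x y; rewrite !scale1r.
pose contraction h r := exists g,
  [/\ [/\ linear h, continuous g, cancel h g & cancel g h],
      forall v, Xs v -> Xs (h v) /\ N (h v) <= r * N v,
      forall w, Xu w -> Xu (h w)
    & forall w, Xu w -> Xu (g w) /\ N (g w) <= r * N w].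
have [lam [lam0 lam1 Alam]] : exists r : R,
    [/\ 0 < r, r < 1 & forall h, A h -> contraction h r].
  apply: finite_uniform_lt1 => //.
    move=> h r1 r2 r12 [g [hg hs hu gu]]; exists g; split => //.
      move=> v /hs[hv hN]; split => //.
      by rewrite (le_trans hN)// ler_wpM2r// (adapted_norm_ge0 Nnorm).
    move=> w /gu[gw gN]; split => //.
    by rewrite (le_trans gN)// ler_wpM2r// (adapted_norm_ge0 Nnorm).
  move=> h /Ah[_ _ _ _ [g [[hl hc gc hK gK] hXs hXu hs1 gu1]]].
  have gl : linear g.
    by move=> a x y; apply: (can_inj hK); rewrite gK hl !gK.
  have [r1 r11 hr1] := restr_opnorm_lt1 Nnorm hl Xs_sub hs1.
  have [r2 r21 gr2] := restr_opnorm_lt1 Nnorm gl Xu_sub gu1.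
  exists (Num.max r1 r2); first by rewrite gt_max r11.
  exists g; split => //.
  - move=> v Xsv; split; first by rewrite -hXs; exists v.
    rewrite (le_trans (hr1 v Xsv))// ler_wpM2r ?(adapted_norm_ge0 Nnorm)//.
    by rewrite le_max lexx.
  - by move=> w Xuw; rewrite -hXu; exists w.
  - move=> w Xuw; split.
      by move: Xuw; rewrite -{1}hXu => -[z Xuz <-]; rewrite hK.
    rewrite (le_trans (gr2 w Xuw))// ler_wpM2r ?(adapted_norm_ge0 Nnorm)//.
    by rewrite le_max lexx orbT.
(* Index shift: [g n] inverts [f n.+1], the map from time [n] to time [n.+1]. *)
have /choice[g fg] n := Alam _ (fA n.+1 isT).
have flin n : linear (f n.+1) by have [[]] := fg n.
have fK n : cancel (f n.+1) (g n) by have [[]] := fg n.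
have gK n : cancel (g n) (f n.+1) by have [[]] := fg n.
have fs n v : Xs v -> Xs (f n.+1 v) /\ N (f n.+1 v) <= lam * N v.
  by have [_ + _ _] := fg n; exact.
have gu n w : Xu w -> Xu (g n w) /\ N (g n w) <= lam * N w.
  by have [_ _ _] := fg n; exact.
(* The splitting is common to the family, so bounding one map suffices to bound the projections. *)
have [B fB] : exists B, forall x, N (f 1%N x) <= B * N x.
  pose F : {linear X -> X} :=
    HB.pack (f 1%N) (GRing.isLinear.Build _ _ _ _ (f 1%N) f1lin).
  have : bounded_near F (nbhs 0).
    by apply: continuous_linear_bounded; exact: f1cont.
  move=> /linear_boundedP[r [_ /(_ (Num.max (r + 1) 0))]].
  rewrite lt_max ltrDl ltr01 => /(_ isT) Fr.
  (* The maximum with 0 provides a nonnegative operator bound, and [C / c] is the cost of passing to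
     [N] on both sides. *)
  exists (C * (Num.max (r + 1) 0 / c)) => x.
  rewrite (le_trans (cNC _).2)// -mulrA ler_pM2l// (le_trans (Fr x))//.
  rewrite -mulrA ler_wpM2l ?le_max ?lexx ?orbT//.
  by rewrite ler_pdivlMl// (cNC x).1.
have [K K0 proj] : exists2 K : R, 0 < K & forall x, exists v w,
    [/\ Xs v, Xu w, x = v + w, N v <= K * N x & N w <= K * N x].
  apply: (hyperbolic_projections_bounded Nnorm XsXu lam0 lam1
    (linD _ (flin 0%N)) (fK 0%N) fB).
  - by move=> v /(fs 0%N)[].
  - by have [] := fg 0%N.
  - by move=> w /(gu 0%N)[].
have sub0 (V : set X) : submod_closed [in V] -> V 0.
  by case; rewrite inE.
have subZD (V : set X) a x y :
    submod_closed [in V] -> V x -> V y -> V (a *: x + y).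
  by move=> [_ /(_ a x y)]; rewrite !inE => h Vx Vy; apply: h.
have XsB x y : Xs x -> Xs y -> Xs (x - y).
  by move=> Xsx Xsy; rewrite addrC -scaleN1r; exact: subZD.
have XuD x y : Xu x -> Xu y -> Xu (x + y).
  by move=> Xux Xuy; rewrite -(scale1r x); exact: subZD.
have gD n x y : g n (x + y) = g n x + g n y.
  by apply: (can_inj (fK n)); rewrite (linD _ (flin n)) !gK.
have gcont n : continuous (g n) by have [[]] := fg n.
have [M M0 correction] := hyperbolic_correction Nnorm Nequiv
  (sub0 _ Xs_sub) XsB (sub0 _ Xu_sub) XuD K0 proj lam0 lam1
  (fun n => linD _ (flin n)) gD gcont gK fs gu.
(* Each shadowing notion only has to supply bounded errors, and one [p] then serves every clause. *)
have shadow x : (exists E, forall n, `|x n.+1 - f n.+1 (x n)| <= E) ->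
    exists p,
    [/\ forall d, (forall n, `|f n.+1 (x n) - x n.+1| <= d) ->
          forall n, `|tv_iter f n p - x n| <= M * d,
        limit_pseudo_orbit f x -> limit_shadows f p x
      & forall theta, lam < theta -> theta < 1 ->
          exp_limit_pseudo_orbit f theta x ->
          exp_cvg0 theta (fun n => `|tv_iter f n p - x n|)].
  move=> /correction[y [yE yd ylim yexp]].
  exists (x 0%N + y 0%N).
  have pE n : tv_iter f n (x 0%N + y 0%N) - x n = y n.
    elim: n => [|n IHn] /=; first by rewrite addrC addKr.
    rewrite yE -IHn opprB addrA; congr (_ - _).
    by rewrite -(linD _ (flin n)) subrK.
  have eE : (fun n => `|x n.+1 - f n.+1 (x n)|) =
      (fun n => `|f n.+1 (x n) - x n.+1|) by apply/funext => n; rewrite distrC.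
  have yn : (fun n => `|tv_iter f n (x 0%N + y 0%N) - x n|) = (fun n => `|y n|).
    by apply/funext => n; rewrite pE.
  rewrite /limit_shadows /limit_pseudo_orbit /exp_limit_pseudo_orbit -eE yn.
  by split => // d ed n; rewrite pE; apply: yd => k; rewrite distrC.
have slim : s_limit_shadowing f.
  (* Halving turns the weak bound [M * delta] into a strict one. *)
  move=> eps eps0; exists (eps / 2 / M).
    by rewrite !(mulr_gt0, invr_gt0)// ltr0n.
  move=> x xpo.
  have [|p [pd plim _]] := shadow x.
    by exists (eps / 2 / M) => n; rewrite distrC ltW.
  have px : eps_shadows f eps p x.
    move=> n; rewrite (le_lt_trans (pd _ (fun n => ltW (xpo n)) n))//.
    by rewrite mulrC divfK ?gt_eqF//; lra.
  by split; [exists p|move=> /plim; exists p].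
split; [|split; [|split => //]].
- by move=> eps /slim[d d0 dP]; exists d => // x /dP[].
- move=> x xlim.
  have [|p [_ plim _]] := shadow x; last by exists p; exact: plim.
  have /cvg_seq_bounded : cvgn (fun n => `|f n.+1 (x n) - x n.+1|).
    by apply/cvg_ex; exists 0.
  move=> [E [_ /(_ (E + 1))]]; rewrite ltrDl => /(_ ltr01) xE.
  by exists (E + 1) => n; rewrite distrC -[leLHS]normr_id; exact: xE.
(* The threshold [theta0] is the common contraction rate; the errors are bounded by [L] because
   [th ^+ n <= 1]. *)
- exists lam; split => // th lamth th1 x xexp.
  have [|p [_ _ pexp]] := shadow x; last by exists p; exact: pexp.
  have [L L0 xL] := xexp; exists L => n.
  have th0 := lt_trans lam0 lamth.
  rewrite distrC -[leLHS]normr_id (le_trans (xL n))// ler_piMr ?(ltW L0)//.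
  by rewrite exprn_ile1 ?ltW.
Qed.
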